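(* Assume $\mathfrak{p}=\mathfrak{c}$. Then there exists a countable zero-dimensional Fréchet–Urysohn $\alpha_4$ space $X$ without isolated points which is not $H$-separable.
   Context: $\mathfrak{p}$ is the pseudointersection number and $\mathfrak{c}$ is the cardinality of the continuum. As in Engelking's book, a zero-dimensional space is a nonempty $T_1$ space with a base of clopen sets. A set $S$ converges to a point $x$ of a space $X$ if $S\setminus U$ is finite for every open neighbourhood $U$ of $x$. A space $X$ is Fréchet–Urysohn if for every $A\subset X$ and $x\in\overline{A}\setminus A$ there is an infinite countable set $S\subset A\setminus\{x\}$ converging to $x$. For $x\in X$ let $\Gamma_x$ be the set of all infinite countable $A\subset X\setminus\{x\}$ which converge to $x$. The space $X$ is an $\alpha_4$ space if for every $x\in X$ and every sequence $\langle S_n:n\in\omega\rangle$ of elements of $\Gamma_x$ there is $S\in\Gamma_x$ such that $S_n\cap S\neq\emptyset$ for infinitely many $n\in\omega$. A space $X$ is $H$-separable if for every sequence $\langle D_n:n\in\omega\rangle$ of dense subsets of $X$ there are finite sets $F_n\subset D_n$, $n\in\omega$, such that every nonempty open subset of $X$ meets all but finitely many of the $F_n$. *)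

(* Defs.v *)
From mathcomp Require Import all_boot.
From mathcomp Require Import boolp classical_sets functions cardinality topology.

Set Implicit Arguments.
Unset Strict Implicit.
Unset Printing Implicit Defensive.

Local Open Scope classical_set_scope.
Local Open Scope card_scope.

Definition strong_fip (F : set (set nat)) :=
  forall G, finite_set G -> G `<=` F -> infinite_set (\bigcap_(A in G) A).

Definition pseudointersection (F : set (set nat)) (P : set nat) :=
  infinite_set P /\ forall A, F A -> finite_set (P `\` A).

Definition sfip_without_pseudointersection (F : set (set nat)) :=
  strong_fip F /\ ~ exists P, pseudointersection F P.

(* Cardinals are represented by sets up to equipotence: this says that #|K| is
   the least cardinality of a family of subsets of nat with the strong finite
   intersection property and no infinite pseudointersection. *)
Definition is_pseudointersection_number (T : Type) (K : set T) :=
  (exists2 F, sfip_without_pseudointersection F & F #= K) /\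
  (forall F, sfip_without_pseudointersection F -> K #<= F).

(* 2 ^ aleph_0 *)
Definition continuum : set (set nat) := [set: set nat].

Section Spaces.
Variable X : topologicalType.

(* Engelking's notion; topology's [zero_dimensional] only asks that clopen sets
   separate points, which is weaker. *)
Definition zero_dimensional_space :=
  [/\ [set: X] !=set0, accessible_space X &
      exists2 B : set (set X), B `<=` clopen & basis B].

Definition set_converges (S : set X) (x : X) :=
  forall U, open U -> U x -> finite_set (S `\` U).

(* Gamma_x *)
Definition convergent_sets (x : X) : set (set X) :=
  [set S | [/\ infinite_set S, countable S, S `<=` ~` [set x] &
               set_converges S x]].

Definition frechet_urysohn :=
  forall (A : set X) (x : X), (closure A `\` A) x ->
    exists2 S, S `<=` A & convergent_sets x S.

Definition alpha4 :=
  forall (x : X) (S : nat -> set X), (forall n, convergent_sets x (S n)) ->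
    exists2 T, convergent_sets x T &
      infinite_set [set n | S n `&` T !=set0].

Definition H_separable :=
  forall D : nat -> set X, (forall n, dense (D n)) ->
    exists F : nat -> set X,
      (forall n, finite_set (F n) /\ F n `<=` D n) /\
      (forall U, open U -> U !=set0 ->
         finite_set [set n | ~ (U `&` F n !=set0)]).

End Spaces.

(* Main.v *)
(* The space is [nat] with the topology generated by the sets of a family [Ws]
   and their complements, where [Ws] starts with the 2-adic balls and grows in a
   recursion of length [c].  Along with [Ws] grows a family [Cs] of pairs (x, S)
   such that S converges to x for every set of [Ws], past and future.  Initially
   [Cs] contains, for all x and n, a sequence of numbers of colour n converging
   to x; hence the colour classes D_n stay dense and no point is ever isolated.
   At each stage fewer than [c] = [p] requirements have been imposed, so [p]
   provides both:
   - if x is in the closure of every A_n \ {x}, a sequence converging to x which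
     meets infinitely many A_n and is added to [Cs]; with A_n constant this gives
     the Frechet-Urysohn property, and with A_n convergent it gives alpha_4;
   - for finite F_n in D_n, a set W <> nat containing infinitely many F_n and
     compatible with [Cs]; the complement of W then shows that (F_n) does not
     witness H-separability.
   The second step needs an infinite set J of colours such that every sequence in
   [Cs] takes only finitely many colours in J.  Such sets J are kept in a tower,
   decreasing modulo finite: a new sequence may be thinned out so that it avoids
   an infinite subset of J. *)
Require Import Defs.
From HB Require Import structures.
From mathcomp Require Import all_boot.
From mathcomp Require Import wochoice.
From mathcomp Require Import boolp classical_sets functions cardinality topology.
From mathcomp Require Import filter.

Set Implicit Arguments.
Unset Strict Implicit.
Unset Printing Implicit Defensive.

Local Open Scope classical_set_scope.
Local Open Scope card_scope.

(** * Cardinals below the continuum and transfinite recursion *)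

(** Cardinality below c, in the negated form that the lower bound in [is_pseudointersection_number]
    contradicts directly. *)
Definition small T (A : set T) := ~ (continuum #<= A).

Lemma card_le_setTP T U (B : set U) :
  [set: T] #<= B <-> exists2 f : T -> U, (forall x, B (f x)) & injective f.
Proof.
split=> [/card_leP[g]|[f fB finj]].
  exists (fun x => val (g (to_setT x))); first by move=> x; exact: set_valP.
  move=> x y /val_inj e; have /(congr1 val) // : to_setT x = to_setT y.
  by apply: (@inj _ _ _ g) => //; rewrite inE.
apply: card_le_trans (subset_card_le (_ : range f `<=` B)); last first.
  by move=> _ [x _ <-].
by have /card_eqPle[] := inj_card_eq (A := setT) (in2W finj).
Qed.

Lemma sub_small T U (A : set T) (B : set U) : A #<= B -> small B -> small A.
Proof. by move=> AB sB cA; apply: sB; exact: card_le_trans cA AB. Qed.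

Lemma small_image T U (f : T -> U) (A : set T) : small A -> small (f @` A).
Proof. exact/sub_small/card_image_le. Qed.

Lemma small_countable T (A : set T) : countable A -> small A.
Proof.
move=> cA lecA; have /card_le_setTP[f _ finj] := card_le_trans lecA cA.
pose D := [set n | exists2 B, f B = n & ~ B n].
have nD : ~ D (f D) by move=> Df; have [B /finj -> /(_ Df)] := Df.
by apply: (nD); exists D.
Qed.

(** An injective coding of pairs, witnessing c * c <= c. *)
Definition set_pair (A B : set nat) : set nat :=
  [set n | if odd n then B n./2 else A n./2].

Lemma set_pair_inj A B A' B' : set_pair A B = set_pair A' B' -> A = A' /\ B = B'.
Proof.
move=> e; split; rewrite predeqE => n.
  by have := congr1 (fun C => C n.*2) e; rewrite /set_pair /= odd_double doubleK => ->.
have := congr1 (fun C => C n.*2.+1) e.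
by rewrite /set_pair /= odd_double /= uphalf_double => ->.
Qed.

(* If the square [c * c] is covered by [A] and [B], then either some column
   lies in [A], or [B] meets every column. *)
Lemma small_setU T (A B : set T) : small A -> small B -> small (A `|` B).
Proof.
move=> sA sB /card_le_setTP[f fAB finj].
have [[a fA]|noA] := pselect (exists a, forall b, A (f (set_pair a b))).
  apply/sA/card_le_setTP; exists (fun b => f (set_pair a b)) => //.
  by move=> b b' /finj/set_pair_inj[].
have /choice[g gP] : forall a, exists b, B (f (set_pair a b)).
  move=> a; apply: contrapT => noB; apply: noA; exists a => b.
  by have [//|Bf] := fAB (set_pair a b); case: noB; exists b.
apply/sB/card_le_setTP; exists (fun a => f (set_pair a (g a))) => //.
by move=> a a' /finj/set_pair_inj[].
Qed.


(** The order is a well-order of all sets of naturals, cut at the least point with c predecessors if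
    there is one. The map [t] lets the stages run through c many tasks. *)
Lemma continuum_index : exists (T : Type) (R : T -> T -> Prop),
  [/\ well_founded R, forall a b c, R a b -> R b c -> R a c,
      forall a b, [\/ R a b, a = b | R b a],
      forall a, small [set b | R b a] &
      exists t : T -> set nat, forall A, exists a, t a = A].
Proof.
have [r rwo] := well_ordering_principle (set nat : eqType).
pose lt (a b : set nat) := r a b /\ a <> b.
have rch : wo_chain r predT by move=> A _; exact: rwo.
have rtot a b : r a b \/ r b a by apply/orP; exact: (wo_chainW rch).
have ranti a b : r a b -> r b a -> a = b.
  by move=> ab ba; apply: (wo_chain_antisymmetric rch) => //; rewrite ab ba.
have rmin (A : set (set nat)) : A !=set0 -> exists2 z, A z & forall x, A x -> r z x.
  move=> [x Ax]; have [|z [[/asboolP zA zmin] _]] := rwo [pred x | `[< A x >]].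
    by exists x; apply/asboolP.
  by exists z => // y Ay; apply: zmin; apply/asboolP.
have rtrans a b c : r a b -> r b c -> r a c.
  (* Transitivity comes from the least element of the set of [a], [b] and [c]. *)
  move=> ab bc; have [|z zE zmin] := rmin [set x | [\/ x = a, x = b | x = c]].
    by exists a; constructor.
  have [za zb zc] : [/\ r z a, r z b & r z c] by split; apply: zmin; constructor.
  case: zE => zE; subst z => //; first by rewrite (ranti a b).
  by rewrite -(ranti b c).
have ltwf : well_founded lt.
  move=> a; apply: contrapT => nacc.
  have [z nz zmin] := rmin [set x | ~ Acc lt x] (ex_intro _ a nacc).
  apply: nz; constructor => y [yz neq]; apply: contrapT => /zmin zy.
  by apply: neq; exact: ranti.
have lttrans a b c : lt a b -> lt b c -> lt a c.
  move=> [ab neq] [bc _]; split; first exact: rtrans bc.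
  by move=> e; apply: neq; apply: ranti => //; rewrite e.
have lttri a b : [\/ lt a b, a = b | lt b a].
  have [->|neq] := pselect (a = b); first by constructor 2.
  by have [ab|ba] := rtot a b; [constructor 1|constructor 3; split=> // /esym].
suff [D [leD sD]] : exists D : set (set nat), continuum #<= D /\
    forall a, D a -> small [set b | D b /\ lt b a].
  have /card_le_setTP[f fD finj] := leD.
  exists {a | D a}, (fun a b => lt (sval a) (sval b)); split.
  - move=> [a Da]; elim: {a}(ltwf a) Da => a _ IH Da; constructor => -[b Db] /=.
    by move=> /IH; exact.
  - by move=> a b c; exact: lttrans.
  - move=> [a Da] [b Db]; case: (lttri a b) => h; [by constructor 1| |by constructor 3].
    by constructor 2; exact: eq_exist.
  - move=> [a Da] /card_le_setTP[g gR ginj]; apply: (sD _ Da).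
    apply/card_le_setTP; exists (fun x => sval (g x)).
      by move=> x; split; [exact: (svalP (g x))|exact: gR].
    move=> x y e; apply: ginj; move: e; case: (g x) (g y) => [u Du] [v Dv] /= uv.
    exact: eq_exist.
  - exists (fun y => xget set0 [set A | f A = sval y]) => A.
    exists (exist _ (f A) (fD A)); apply: finj.
    exact: (@xgetI _ set0 [set B | f B = f A] A).
have [[a0 a0c]|noc] := pselect (exists a, continuum #<= [set b | lt b a]); last first.
  exists setT; split; first exact: card_lexx.
  move=> a _ ca; apply: noc; exists a; apply: card_le_trans ca _.
  by apply: subset_card_le => b [].
have [a ac amin] := rmin [set a | continuum #<= [set b | lt b a]] (ex_intro _ a0 a0c).
exists [set b | lt b a]; split => // b [ba neq] cb; apply: neq; apply: ranti => //.
by apply: amin; apply: card_le_trans cb _; apply: subset_card_le => c [].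
Qed.

(** Recursion in which a value need only exist when the earlier values are good. The choice function
    [G] falls back on a default, so the recursion is defined first and an induction then shows that
    solutions always exist. *)
Lemma wf_choice T Y (R : T -> T -> Prop) (P : T -> (T -> Y) -> Y -> Prop) :
  inhabited Y -> well_founded R ->
  (forall a f g y, (forall b, R b a -> f b = g b) -> P a f y -> P a g y) ->
  (forall a f, (forall b, R b a -> P b f (f b)) -> exists y, P a f y) ->
  exists f, forall a, P a f (f a).
Proof.
move=> [y0] Rwf Pext Pex.
have /choice[G GP] : forall af : T * (T -> Y), exists y,
    (exists z, P af.1 af.2 z) -> P af.1 af.2 y.
  move=> [a f]; have [[y Py]|nP] := pselect (exists z, P a f z).
    by exists y.
  by exists y0.
pose body a (rec : forall b, R b a -> Y) : Y :=
  G (a, fun b => if pselect (R b a) is left h then rec b h else y0).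
pose f := Fix Rwf (fun=> Y) body.
have fE a : f a = G (a, fun b => if pselect (R b a) is left _ then f b else y0).
  rewrite /f Fix_eq // => x u v uv; congr G; congr pair.
  by apply/funext => b; case: pselect.
exists f; apply: (well_founded_ind Rwf) => a IH.
have [y Py] := Pex _ _ IH.
have agree b : R b a -> f b = if pselect (R b a) is left _ then f b else y0.
  by case: pselect.
rewrite fE; apply: (Pext) (GP (a, _) _) => /= [b /agree//|].
by exists y; exact: Pext Py.
Qed.

(** * Applications of the pseudointersection number *)

Lemma filter_bigcap T I (F : set_system T) (D : set I) (f : I -> set T) :
  Filter F -> finite_set D -> (forall i, D i -> F (f i)) ->
  F (\bigcap_(i in D) f i).
Proof.
elim/Pchoice: I => I in D f *.
by move=> FF /finite_fsetP[E ->] DF; apply: filter_bigI => i iD; exact: DF.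
Qed.

Lemma infinite_image_inj T U (f : T -> U) (A : set T) :
  injective f -> infinite_set A -> infinite_set (f @` A).
Proof. by move=> finj; rewrite (eq_finite_set (inj_card_eq (in2W finj))). Qed.

Lemma infinite_image_fibers T U (f : T -> U) (A : set T) :
  infinite_set A -> (forall y, finite_set (A `&` f @^-1` [set y])) ->
  infinite_set (f @` A).
Proof.
move=> Ainf fib fin; apply: Ainf.
apply: sub_finite_set (bigcup_finite fin (fun y _ => fib y)) => x Ax.
by exists (f x) => //; exists x.
Qed.

Lemma setUIDK T (A B : set T) : (A `&` B) `|` (A `\` B) = A.
Proof. by rewrite setDE -setIUr setUv setIT. Qed.

Lemma infinite_almost_sub T (P A : set T) :
  infinite_set P -> finite_set (P `\` A) -> infinite_set (P `&` A).
Proof.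
move=> Pinf PA fin; apply: Pinf; rewrite -(setUIDK P A).
by rewrite finite_setU.
Qed.

Lemma infinite_split (J : set nat) : infinite_set J ->
  exists J1 J2, [/\ infinite_set J1, infinite_set J2, J1 `<=` J, J2 `<=` J &
                    forall n, J1 n -> ~ J2 n].
Proof.
move=> /infiniteP/card_le_setTP[e eJ einj].
exists (range (fun n => e n.*2)), (range (fun n => e n.*2.+1)); split.
- apply/infiniteP/card_le_setTP; exists (fun n => e n.*2).
    by move=> n; exists n.
  move=> m n /einj.
  exact: double_inj.
- apply/infiniteP/card_le_setTP; exists (fun n => e n.*2.+1).
    by move=> n; exists n.
  move=> m n /einj[].
  exact: double_inj.
- by move=> _ [n _ <-].
- by move=> _ [n _ <-].
- move=> _ [n _ <-] [m _] /einj mn.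
  by have := congr1 odd mn; rewrite /= !odd_double.
Qed.

(* Split [J] into two infinite halves: either infinitely many points of [P] are
   mapped into the first half, or infinitely many are mapped outside of it. *)
Lemma infinite_thin T (d : T -> nat) (P : set T) (J : set nat) :
  infinite_set P -> infinite_set J ->
  exists P' J', [/\ P' `<=` P, infinite_set P', J' `<=` J, infinite_set J' &
                    forall p, P' p -> ~ J' (d p)].
Proof.
move=> Pinf /infinite_split[J1 [J2 [J1inf J2inf J1J J2J J12]]].
have [fin|inf] := pselect (finite_set (P `&` d @^-1` J1)).
  exists (P `\` d @^-1` J1), J1; split=> // [|p []//].
  by move=> fin'; apply: Pinf; rewrite -(setUIDK P (d @^-1` J1)) finite_setU.
by exists (P `&` d @^-1` J1), J2; split=> // p [] // _; exact: J12.
Qed.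

(* The filter [Phi] serves to check the strong finite intersection property. *)
Lemma filter_pseudointersection (T : countType) (Phi : set_system T)
    (F : set (set T)) :
  is_pseudointersection_number continuum ->
  Filter Phi -> (forall A, Phi A -> infinite_set A) -> F `<=` Phi -> small F ->
  exists2 P, infinite_set P & forall A, F A -> finite_set (P `\` A).
Proof.
move=> [_ pc] FPhi Phi_inf FPhi' sF.
(* Adding [setT] puts the range of [pickle] into the family, so that almost all of [P] consists of
   codes. *)
pose F' := (fun A => pickle @` A) @` (F `|` [set setT]) : set (set nat).
have pinj : injective (@pickle T) by exact: pcan_inj pickleK.
have sF' : small F'.
  by apply: small_image; apply: small_setU => //; exact: small_countable.
have F'fip : strong_fip F'.
  move=> G Gfin GF'.
  have : Phi (\bigcap_(B in G) (pickle @^-1` B)).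
    apply: filter_bigcap => // B /GF'[A FA <-].
    have -> : pickle @^-1` (pickle @` A) = A.
      by apply/seteqP; split=> [t [u Au /pinj <-]|t At]//; exists t.
    by case: FA => [/FPhi'//|->]; exact: filterT.
  move=> /Phi_inf/(infinite_image_inj pinj); apply: sub_infinite_set.
  by move=> _ [t tG <-] B /tG.
have [P [Pinf PF']] : exists P, pseudointersection F' P.
  by apply: contrapT => nP; apply/sF'/pc.
exists (pickle @^-1` P) => [fin|A FA].
  apply: Pinf; apply: sub_finite_set (_ : _ `<=`
    pickle @` (pickle @^-1` P) `|` (P `\` range (@pickle T))) _.
    move=> n Pn; have [[t _ tn]|nr] := pselect (range (@pickle T) n); last by right.
    by left; exists t => //; rewrite /preimage/= tn.
  rewrite finite_setU; split; first exact: finite_image.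
  by apply: PF'; exists setT => //; right.
have := PF' (pickle @` A) (ex_intro2 _ _ A (or_introl FA) erefl).
move=> /(finite_preimage (f := @pickle T)) h.
apply: sub_finite_set (h _); last exact: in2W.
by move=> t [Pt nAt]; split=> // -[u Au /pinj ut]; apply: nAt; rewrite -ut.
Qed.

(** For finite [G], a basic clopen neighbourhood of [x] in the topology generated by a family
    containing [G]. *)
Definition agree T (G : set (set T)) (x : T) : set T :=
  [set y | forall W, G W -> (W y <-> W x)].

(* [S] is eventually on the same side of [W] as [x], for [c] = (x, S). *)
Definition respects T (W : set T) (c : T * set T) :=
  finite_set [set s | c.2 s /\ ~ (W s <-> W c.1)].

Lemma agreeU T (G H : set (set T)) x :
  agree (G `|` H) x = agree G x `&` agree H x.
Proof.
apply/seteqP; split=> [y xy|y [Gxy Hxy] W [GW|HW]].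
- by split=> W ?; apply: xy; [left|right].
- exact: Gxy.
- exact: Hxy.
Qed.

(** The chain condition makes the sets that almost contain a member of [Js] a filter of infinite
    sets. *)
Lemma chain_pseudointersection (Js : set (set nat)) :
  is_pseudointersection_number continuum ->
  Js !=set0 -> (forall J, Js J -> infinite_set J) ->
  (forall J K, Js J -> Js K -> finite_set (J `\` K) \/ finite_set (K `\` J)) ->
  small Js ->
  exists2 J, infinite_set J & forall K, Js K -> finite_set (J `\` K).
Proof.
move=> pc [J0 J0Js] Jinf Jch sJ.
pose Phi : set_system nat := fun A => exists2 J, Js J & finite_set (J `\` A).
have FPhi : Filter Phi.
  split.
  - by exists J0 => //; rewrite setDT.
  - suff H A B J K : Js J -> finite_set (J `\` K) ->
        finite_set (J `\` A) -> finite_set (K `\` B) -> Phi (A `&` B).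
      move=> A B [J JJ JA] [K KK KB];
      have [JK|KJ] := Jch _ _ JJ KK; first exact: H JJ JK JA KB.
      by rewrite setIC; exact: H KK KJ KB JA.
    move=> JJ JK JA KB; exists J => //.
    apply: sub_finite_set (_ : _ `<=` (J `\` A) `|` ((J `\` K) `|` (K `\` B))) _; last first.
      by rewrite !finite_setU.
    move=> n [Jn nAB]; have [An|] := pselect (A n); last by left.
    have [Kn|] := pselect (K n); last by right; left.
    by right; right; split=> // Bn; apply: nAB.
  - move=> A B AB [J JJ JA]; exists J => //; apply: sub_finite_set JA.
    by move=> n [Jn nB]; split=> // /AB.
apply: filter_pseudointersection pc FPhi _ _ sJ.
  move=> A [J JJ JA]; apply: sub_infinite_set (infinite_almost_sub (Jinf _ JJ) JA).
  exact: subIsetr.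
by move=> J JJ; exists J => //; rewrite setDv.
Qed.

Lemma convergent_selection (T : countType) (Ws : set (set T)) (x : T)
    (A : nat -> set T) :
  is_pseudointersection_number continuum -> small Ws ->
  (forall t, t <> x -> exists2 W, Ws W & ~ (W t <-> W x)) ->
  (forall n G, finite_set G -> G `<=` Ws ->
    ((A n `\ x) `&` agree G x) !=set0) ->
  exists P : set (nat * T),
    [/\ infinite_set P, forall n s, P (n, s) -> A n s /\ s <> x,
        forall n, finite_set (P `&` fst @^-1` [set n]),
        forall s, finite_set (P `&` snd @^-1` [set s]) &
        forall W, Ws W -> finite_set [set p | P p /\ ~ (W p.2 <-> W x)]].
Proof.
move=> pc sW sep cl.
pose D := [set jG : nat * set (set T) | finite_set jG.2 /\ jG.2 `<=` Ws].
pose B (jG : nat * set (set T)) := [set p : nat * T |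
  [/\ (jG.1 <= p.1)%N, (A p.1 `\ x) p.2 & agree jG.2 x p.2]].
have FPhi : Filter (filter_from D B).
  apply: filter_from_filter; first by exists (0, set0); split=> //.
  move=> [j G] [k H] [/= Gfin GW] [/= Hfin HW].
  exists (maxn j k, G `|` H).
    by split; rewrite /= ?finite_setU // => W [/GW|/HW].
  by move=> p [/=]; rewrite geq_max agreeU => /andP[jp kp] Ap [Gp Hp].
pose Q W := [set p : nat * T | W p.2 <-> W x].
pose Q0 := [set p : nat * T | (A p.1 `\ x) p.2].
pose N j := [set p : nat * T | (j <= p.1)%N].
have [|||P0 P0inf P0F] :=
  @filter_pseudointersection _ _ (Q @` Ws `|` (range N `|` [set Q0])) pc FPhi.
(* A member of the filter has points over every [n >= j], because each [A n] accumulates at [x]. *)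
- move=> R [[j G] [/= Gfin GW] BR] Rfin.
  have : finite_set (fst @` R) by exact: finite_image.
  apply: (@sub_infinite_set _ [set n | (j <= n)%N]).
    move=> n /= jn; have [s [As xs]] := cl n G Gfin GW.
    by exists (n, s) => //; apply: BR.
  apply/infiniteP/card_le_setTP; exists (addn j); last exact: addnI.
  by move=> n /=; rewrite leq_addr.
- move=> R [[W WW <-]|[[j _ <-]|->]].
  + exists (0, [set W]); first by split=> //= _ ->.
    by move=> p [_ _ /(_ W erefl)].
  + by exists (j, set0) => [|p []//]; split=> //=.
  + by exists (0, set0) => [|p []//]; split=> //=.
- apply: small_setU; first exact: small_image.
  apply: small_setU; apply: small_countable; last exact: countable1.
  exact: (card_image_le N [set: nat]).
have P0Q0 : finite_set (P0 `\` Q0) by apply: P0F; right; right.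
exists (P0 `&` Q0); split.
- exact: infinite_almost_sub.
- by move=> n s [_ []].
- move=> n; have : finite_set (P0 `\` N n.+1) by apply: P0F; right; left; exists n.+1.
  by apply: sub_finite_set => p [[P0p _] <-]; split=> //; rewrite /N/= ltnn.
- move=> s; have [->|/sep[W WW nW]] := pselect (s = x).
    by apply: sub_finite_set (finite_set0 _) => p [[_ [_ px]] /px].
  have : finite_set (P0 `\` Q W) by apply: P0F; left; exists W.
  by apply: sub_finite_set => p [[P0p _] /= ps]; split=> //; rewrite /Q/= ps.
- move=> W WW; have : finite_set (P0 `\` Q W) by apply: P0F; left; exists W.
  by apply: sub_finite_set => p [[P0p _] nW].
Qed.

Lemma near_notin_finite (D : set nat) :
  finite_set D -> \forall n \near \oo, ~ D n.
Proof.
move=> Dfin.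
have : \forall n \near \oo, (\bigcap_(i in D) [set n | n <> i]) n.
  apply: filter_bigcap => // i _; exists i.+1 => // n /= lt_in ni.
  by rewrite ni ltnn in lt_in.
by apply: filterS => n nD Dn; exact: (nD n).
Qed.

(* [W] is the union of the [V f m] for [f] in [F n] and (n, m) in a
   pseudointersection of the sets of all (n, m) for which these [V f m] miss
   [S] and [x], where (x, S) ranges over [Cs].  Almost all of them thus miss [S],
   and the others contain only finitely many points of [S] unless they contain
   [x]. *)
Lemma avoiding_cover (T : countType) (d : T -> nat) (V : T -> nat -> set T)
    (Cs : set (T * set T)) (c0 : T * set T) (J : set nat) (F : nat -> set T) :
  is_pseudointersection_number continuum -> small Cs -> Cs c0 ->
  (forall x m, V x m x) ->
  (forall c x m, Cs c -> respects (V x m) c) ->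
  (forall c x, Cs c -> x <> c.1 -> ~ c.2 x ->
    \forall m \near \oo, forall y, V x m y -> y <> c.1 /\ ~ c.2 y) ->
  infinite_set J ->
  (forall c, Cs c -> finite_set (J `&` d @` c.2)) ->
  (forall n, finite_set (F n) /\ F n `<=` d @^-1` [set n]) ->
  exists W, [/\ ~ W c0.1, infinite_set [set n | F n `<=` W] &
                forall c, Cs c -> respects W c].
Proof.
move=> pc sC Cc0 Vx Vresp Vavoid Jinf JC FD.
(* An iterated filter: [n] grows along [J], and how large [m] must be may depend on [n] through the
   finite set [F n]. *)
pose Phi : set_system (nat * nat) := fun Q =>
  \forall n \near within J \oo, \forall m \near \oo, Q (n, m).
have FPhi : Filter Phi.
  split; rewrite /Phi.
  - by apply: filterE => n; apply: filterE.
  - move=> A B PA PB; apply: filterS2 PA PB => n PA PB.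
    by apply: filterS2 PA PB => m.
  - by move=> A B AB; apply: filterS => n; apply: filterS => m; exact: AB.
pose A (c : T * set T) := [set nm : nat * nat |
  forall f, F nm.1 f -> forall y, V f nm.2 y -> y <> c.1 /\ ~ c.2 y].
pose N j := [set nm : nat * nat | (j <= nm.1)%N].
have [|||P0 P0inf P0F] := @filter_pseudointersection _ _ (A @` Cs `|` range N) pc FPhi.
- move=> R [n0 _ n0P] /(finite_image fst) Rfin; apply: Jinf.
  apply: sub_finite_set (_ : _ `<=` (fst @` R `|` `I_n0)) _; last first.
    by rewrite finite_setU; split=> //; exact: finite_II.
  move=> n Jn; have [lt|ge] := ltnP n n0; first by right.
  have [m _ /(_ m (leqnn m)) Rnm] := n0P n ge Jn.
  by left; exists (n, m).
- move=> R [[c Cc <-]|[j _ <-]].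
    (* Without the colour of [c.1] and the finitely many colours in [J] taken by [c.2], no point of
       [F n] is [c.1] or lies in [c.2], so [Vavoid] applies. *)
    have Jd := near_notin_finite (JC c Cc).
    have c1d := near_notin_finite (finite_set1 (d c.1)).
    apply: (@filterS2 _ \oo _ _ _ _ _ c1d Jd) => n /= nd nJd Jn.
    have [Fn Fd] := FD n.
    have : \forall m \near \oo, (\bigcap_(f in F n)
        [set m | forall y, V f m y -> y <> c.1 /\ ~ c.2 y]) m.
      apply: filter_bigcap => // f /Fd /= df; apply: Vavoid => // [fc|cf].
        by apply: nd; rewrite -df fc.
      by apply: nJd; split=> //; exists f.
    by apply: filterS => m h f Ff; exact: h.
  exists j => // n /= jn _; apply: filterE => m; exact: jn.
- apply: small_setU; first exact: small_image.
  by apply: small_countable; exact: (card_image_le N [set: nat]).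
have P0A c : Cs c -> finite_set (P0 `\` A c) by move=> Cc; apply: P0F; left; exists c.
have P0N j : finite_set (P0 `\` N j) by apply: P0F; right; exists j.
(* Intersecting with [A c0] keeps [c0.1] out of [W] outright, not just up to finitely many pairs. *)
pose P := P0 `&` A c0.
have Pinf : infinite_set P by apply: infinite_almost_sub (P0A _ Cc0).
pose W := [set y | exists nm f, [/\ P nm, F nm.1 f & V f nm.2 y]].
exists W; split.
- by move=> [nm [f [[_ Anm] Ff /(Anm _ Ff)[]]]].
- apply: (@sub_infinite_set _ (fst @` P)).
    by move=> _ [nm Pnm <-] f Ff; exists nm, f; split.
  apply: infinite_image_fibers => // n; apply: sub_finite_set (P0N n.+1).
  by move=> nm [[P0nm _] /= <-]; split=> //; rewrite /N/= ltnn.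
move=> c Cc; have [[nm [f [Pnm Ff Vc]]]|nW] := pselect (W c.1).
  apply: sub_finite_set (Vresp c f nm.2 Cc) => y [cy nWy]; split=> // -[_ h].
  by apply: nWy; split=> // _; exists nm, f; split=> //; exact: h.
have fin : finite_set (\bigcup_(nm in P0 `\` A c) \bigcup_(f in F nm.1)
    [set y | c.2 y /\ ~ (V f nm.2 y <-> V f nm.2 c.1)]).
  apply: bigcup_finite => [|nm _]; first exact: P0A.
  by apply: bigcup_finite => [|f _]; [have [] := FD nm.1|exact: Vresp].
apply: sub_finite_set fin => y [cy nWy].
have [nm [f [Pnm Ff Vy]]] : W y by apply: contrapT => nWy'; apply: nWy.
exists nm; first by split; [case: Pnm|move=> /(_ _ Ff _ Vy)[]].
exists f => //; split=> // -[/(_ Vy) Vc _]; apply: nW.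
by exists nm, f; split.
Qed.

(** * One step of the recursion *)

(** Thinning the pairs by the colour of their points frees an infinite part of [J]. The thinned set
    still meets infinitely many [A n] because the columns are finite. *)
Lemma reserved_selection (T : countType) (d : T -> nat) (Ws : set (set T))
    (x : T) (A : nat -> set T) (J : set nat) :
  is_pseudointersection_number continuum -> small Ws ->
  (forall t, t <> x -> exists2 W, Ws W & ~ (W t <-> W x)) ->
  (forall n G, finite_set G -> G `<=` Ws ->
    ((A n `\ x) `&` agree G x) !=set0) ->
  infinite_set J ->
  exists S J',
    [/\ infinite_set S, S `<=` \bigcup_n (A n `\ x),
        infinite_set [set n | A n `&` S !=set0],
        forall W, Ws W -> respects W (x, S) &
        [/\ J' `<=` J, infinite_set J' & J' `&` d @` S = set0]].
Proof.
move=> pc sW sep cl Jinf.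
have [P [Pinf PA Pfst Psnd PW]] := convergent_selection pc sW sep cl.
have [Q [J' [QP Qinf J'J J'inf QJ']]] := infinite_thin (d \o snd) Pinf Jinf.
exists (snd @` Q), J'; split.
- apply: infinite_image_fibers => // s.
  by apply: sub_finite_set (Psnd s) => p [/QP].
- by move=> _ [[n s] /QP/PA As <-]; exists n.
- apply: (@sub_infinite_set _ (fst @` Q)).
    by move=> _ [[n s] Qns <-]; exists s; split; [have [] := PA _ _ (QP _ Qns)|exists (n, s)].
  by apply: infinite_image_fibers => // n; apply: sub_finite_set (Pfst n) => p [/QP].
- move=> W /PW/(finite_image snd); apply: sub_finite_set => s [[p Qp <-] nW].
  by exists p => //; split=> //; exact: QP.
- split=> //; apply/seteqP; split=> // n [J'n [_ [p Qp <-]] dn].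
  by apply: (QJ' p Qp); rewrite /= dn.
Qed.

(** * 2-adic balls and the colouring of the naturals *)

Definition ball2 (x m : nat) : set nat := [set y | y = x %[mod 2 ^ m]].

(* Takes every value on infinitely many powers of 2, and [x + 2 ^ l] has the same
   color as [2 ^ l] when [x < 2 ^ l]. *)
Definition color (k : nat) : nat := logn 2 (trunc_log 2 k).

Definition color_seq (x n : nat) : set nat :=
  [set x + 2 ^ l | l in [set l | (x < l)%N /\ logn 2 l = n]].

Lemma ball2_sep x y m : (x + y <= m)%N -> ball2 x m y -> y = x.
Proof.
move=> xym; have lt z : (z <= x + y)%N -> (z < 2 ^ m)%N.
  by move=> zle; apply: leq_ltn_trans (ltn_expl m _) => //; exact: leq_trans xym.
by rewrite /ball2/= !modn_small // lt // ?leq_addr ?leq_addl.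
Qed.

Lemma sub_ball2 x m n : (m <= n)%N -> ball2 x n `<=` ball2 x m.
Proof.
move=> mn y /(congr1 (modn^~ (2 ^ m))) /=.
by rewrite !modn_dvdm // dvdn_exp2l.
Qed.

Lemma color_seqP x n s : color_seq x n s -> color s = n.
Proof.
move=> [l [xl <-] <-]; rewrite /color; congr logn.
have xl2 : (x < 2 ^ l)%N by exact: ltn_trans xl (ltn_expl _ _).
by apply: trunc_log_eq => //; rewrite leq_addl /= expnS mul2n -addnn ltn_add2r.
Qed.

Lemma infinite_color_seq x n : infinite_set (color_seq x n).
Proof.
apply/infiniteP/card_le_setTP.
(* The odd factor leaves the 2-adic valuation at [n], and it exceeds [x], which gives [x < l i]. *)
pose l i := (2 ^ n * (x + i).*2.+1)%N.
exists (fun i => x + 2 ^ l i)%N => [i|i j].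
  exists (l i) => //; split.
    rewrite /l; apply: (@leq_trans (x + i).*2.+1); last by rewrite leq_pmull ?expn_gt0.
    by rewrite ltnS -addnn -addnA leq_addr.
  by rewrite /l lognM ?expn_gt0 // pfactorK // logn_coprime ?addn0 // coprime2n /= odd_double.
move=> /addnI/eqP; rewrite eqn_exp2l // /l eqn_pmul2l ?expn_gt0 // => /eqP[/double_inj/addnI].
by [].
Qed.

Lemma respects_color_seq x n y m : respects (ball2 y m) (x, color_seq x n).
Proof.
apply: sub_finite_set (finite_image (fun l => x + 2 ^ l)%N (finite_II m)).
move=> s [[l [_ _] <-] nb]; exists l => //=; rewrite ltnNge; apply/negP => ml.
apply: nb; rewrite /ball2/= -modnDmr.
by have /eqP -> : 2 ^ l %% 2 ^ m == 0; [exact: dvdn_exp2l|rewrite addn0].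
Qed.

(** The ball with exponent [m1] omits [c.1]; as it respects [c], it contains only finitely many
    points of [c.2], and smaller balls exclude these one by one. *)
Lemma near_ball2_avoid (c : nat * set nat) x :
  (forall m, respects (ball2 x m) c) -> x <> c.1 -> ~ c.2 x ->
  \forall m \near \oo, forall y, ball2 x m y -> y <> c.1 /\ ~ c.2 y.
Proof.
move=> cresp xc1 xc2; pose m1 := x + c.1.
have nb : ~ ball2 x m1 c.1 by move=> /ball2_sep e; apply: xc1; rewrite e.
have : \forall m \near \oo,
    (\bigcap_(s in [set s | c.2 s /\ ~ (ball2 x m1 s <-> ball2 x m1 c.1)])
      [set m | ~ ball2 x m s]) m.
  apply: filter_bigcap => [|s [cs _]]; first exact: cresp.
  exists (x + s) => // m /= xsm /ball2_sep -/(_ xsm) e; apply: xc2.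
  by rewrite -e.
apply: (@filterS2 _ \oo _ _ _ _ _ (nbhs_infty_ge m1)) => m /= m1m h y xy.
have y1 := sub_ball2 m1m xy; split=> [e|cy]; first by apply: nb; rewrite -e.
by apply: (h y) => //; split=> // -[/(_ y1)].
Qed.

Definition balls : set (set nat) := range (fun xm => ball2 xm.1 xm.2).

Definition color_seqs : set (nat * set nat) :=
  range (fun xn => (xn.1, color_seq xn.1 xn.2)).

(* [target] is the pair (x, S) added to [Cs], [side] the set added to [Ws], and
   [reserve] the set of colours that later sequences and covers may use. *)
Record stage := Stage {
  target : nat * set nat;
  side : set nat;
  reserve : set nat }.

(* (x, A, F), where the sets A n accumulate at x and F is a candidate selection
   from the colour classes. *)
Definition task := (nat * (nat -> set nat) * (nat -> set nat))%type.

(** The invariant before a stage. By [adm_reserve], a set almost contained in every member of [Js]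
    contains only finitely many colours of each sequence. *)
Record admissible (Cs : set (nat * set nat)) (Ws Js : set (set nat)) : Prop := {
  adm_smallC : small Cs;
  adm_smallW : small Ws;
  adm_smallJ : small Js;
  adm_seqs : color_seqs `<=` Cs;
  adm_balls : balls `<=` Ws;
  adm_full : Js [set: nat];
  adm_respects : forall c W, Cs c -> Ws W -> respects W c;
  adm_inf : forall J, Js J -> infinite_set J;
  adm_chain : forall J K, Js J -> Js K ->
    finite_set (J `\` K) \/ finite_set (K `\` J);
  adm_reserve : forall c, Cs c ->
    exists2 J, Js J & finite_set (J `&` color @` c.2) }.

Record extends (Cs : set (nat * set nat)) (Ws Js : set (set nat)) (y : stage)
    : Prop := {
  ext_target : forall W, Ws W -> respects W (target y);
  ext_side : forall c, Cs c -> respects (side y) c;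
  ext_self : respects (side y) (target y);
  ext_inf : infinite_set (reserve y);
  ext_sub : forall K, Js K -> finite_set (reserve y `\` K);
  ext_reserve : finite_set (reserve y `&` color @` (target y).2) }.

(** The premise puts the point of the task in the closure of each of its sets minus that point, for
    the topology generated by [Ws]. It gets stronger as [Ws] grows, so what a stage achieves stays
    valid for the final family. *)
Definition selects (Ws : set (set nat)) (z : task) (c : nat * set nat) :=
  (forall n G, finite_set G -> G `<=` Ws ->
    ((z.1.2 n `\ z.1.1) `&` agree G z.1.1) !=set0) ->
  [/\ c.1 = z.1.1, infinite_set c.2, c.2 `<=` \bigcup_n (z.1.2 n `\ z.1.1) &
      infinite_set [set n | z.1.2 n `&` c.2 !=set0]].

Definition covers (z : task) (W : set nat) :=
  (forall n, finite_set (z.2 n) /\ z.2 n `<=` color @^-1` [set n]) ->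
  (exists p, ~ W p) /\ infinite_set [set n | z.2 n `<=` W].

(** A lower bound [J] of the tower comes first, then a sequence thinned to free an infinite [J'],
    then a cover using colours in [J']. Built last, the cover respects the new sequence too. *)
Lemma extension Cs Ws Js (z : task) :
  is_pseudointersection_number continuum -> admissible Cs Ws Js ->
  exists y, [/\ extends Cs Ws Js y, selects Ws z (target y) & covers z (side y)].
Proof.
move=> pc adm.
have [J Jinf JJs] := chain_pseudointersection pc (ex_intro _ _ (adm_full adm))
  (adm_inf adm) (adm_chain adm) (adm_smallJ adm).
have [c [J' [cW J'J J'inf J'c zc]]] : exists c J',
    [/\ forall W, Ws W -> respects W c, J' `<=` J, infinite_set J',
        finite_set (J' `&` color @` c.2) & selects Ws z c].
  have [cl|ncl] := pselect (forall n G, finite_set G -> G `<=` Ws ->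
    ((z.1.2 n `\ z.1.1) `&` agree G z.1.1) !=set0); last first.
    exists (0, set0), J; split=> //.
      by move=> W _; apply: sub_finite_set (finite_set0 _) => s [].
    by rewrite image_set0 setI0.
  have sep t : t <> z.1.1 -> exists2 W, Ws W & ~ (W t <-> W z.1.1).
    move=> tx; exists (ball2 z.1.1 (z.1.1 + t)).
      by apply: adm_balls adm _ _; exists (z.1.1, z.1.1 + t).
    by case=> _ /(_ erefl)/ball2_sep e; apply/tx/e.
  have [S [J' [Sinf SA Sn SW [J'J J'inf J'S]]]] :=
    reserved_selection color pc (adm_smallW adm) sep cl Jinf.
  exists (z.1.1, S), J'; split=> //=; first by rewrite J'S.
have adm_c : forall c', (Cs `|` [set c]) c' -> forall W, Ws W -> respects W c'.
  by move=> c' [Cc' W|-> //]; exact: adm_respects adm _ _ Cc'.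
have J'Js K : Js K -> finite_set (J' `\` K).
  by move=> /JJs; apply: sub_finite_set => n [/J'J].
have [W [WC zW]] : exists W,
    (forall c', (Cs `|` [set c]) c' -> respects W c') /\ covers z W.
  have [zF|nzF] := pselect (forall n,
      finite_set (z.2 n) /\ z.2 n `<=` color @^-1` [set n]); last first.
    exists set0; split=> // c' _.
    by apply: sub_finite_set (finite_set0 _) => s [_ []].
  have ballW x m : Ws (ball2 x m) by apply: adm_balls adm _ _; exists (x, m).
  have [||||||W [nW infW WC]] := @avoiding_cover _ color ball2
    (Cs `|` [set c]) c J' z.2 pc _ _ _ _ _ J'inf _ zF.
  - apply: small_setU; first exact: adm_smallC adm.
    exact/small_countable/countable1.
  - by right.
  - by [].
  - by move=> c' x m /adm_c; apply.
  - move=> c' x /adm_c Wc'; apply: near_ball2_avoid => m; exact: Wc'.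
  - move=> c' [Cc'|-> //]; have [K KK Kc'] := adm_reserve adm Cc'.
    apply: sub_finite_set (_ : _ `<=` (J' `\` K) `|` (K `&` color @` c'.2)) _.
      by move=> n [J'n cn]; have [Kn|] := pselect (K n); [right|left].
    by rewrite finite_setU; split=> //; exact: J'Js.
  by exists W; split=> // _; split=> //; exists c.1.
exists (Stage c W J'); split=> //; split=> //=.
- by move=> c' Cc'; apply: WC; left.
- by apply: WC; right.
Qed.

(** * The generic family and its topology *)

Definition code_family (A : nat -> set nat) : set nat :=
  [set k | exists n s, k = pickle (n, s) /\ A n s].

Lemma code_family_inj : injective code_family.
Proof.
suff H A B : code_family A = code_family B -> forall n, A n `<=` B n.
  by move=> A B AB; apply/funext => n; apply/seteqP; split; exact: H.
move=> AB n s As; have : code_family A (pickle (n, s)) by exists n, s.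
by rewrite AB => -[n' [s' [/(pcan_inj pickleK)[-> ->]]]].
Qed.

Definition code_task (z : task) : set nat :=
  set_pair [set z.1.1] (set_pair (code_family z.1.2) (code_family z.2)).

Lemma code_task_inj : injective code_task.
Proof.
move=> [[x A] F] [[y B] G] /set_pair_inj[/= xy /set_pair_inj[]].
move=> /code_family_inj -> /code_family_inj ->; congr (_, _, _).
by have : [set y] x by rewrite -xy.
Qed.

(** Since [code_task] is injective, there are at most c tasks; an index whose set codes no task gets
    a default. *)
Lemma task_enumeration T (t : T -> set nat) :
  (forall A, exists a, t a = A) ->
  exists z : T -> task, forall x, exists a, z a = x.
Proof.
move=> tsurj.
have /choice[z zP] : forall a, exists z,
    (exists x, code_task x = t a) -> code_task z = t a.
  move=> a; have [[x xa]|n] := pselect (exists x, code_task x = t a).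
    by exists x.
  by exists (0, fun=> set0, fun=> set0).
exists z => x; have [a ax] := tsurj (code_task x).
by exists a; apply: code_task_inj; rewrite zP ?ax //; exists x.
Qed.

(** All that the topological part uses of the recursion. *)
Definition generic (Cs : set (nat * set nat)) (Ws : set (set nat)) :=
  [/\ color_seqs `<=` Cs, balls `<=` Ws,
      forall c W, Cs c -> Ws W -> respects W c &
      forall z, exists2 c, Cs c & exists2 W, Ws W &
        selects Ws z c /\ covers z W].

Lemma generic_exists : is_pseudointersection_number continuum ->
  exists Cs Ws, generic Cs Ws.
Proof.
move=> pc.
have [T [R [Rwf Rtr Rtot Rsmall [t /task_enumeration[z zsurj]]]]] := continuum_index.
pose Cs a (f : T -> stage) := color_seqs `|` (target \o f) @` [set b | R b a].
pose Ws a (f : T -> stage) := balls `|` (side \o f) @` [set b | R b a].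
pose Js a (f : T -> stage) := [set setT] `|` (reserve \o f) @` [set b | R b a].
pose P a f y := [/\ extends (Cs a f) (Ws a f) (Js a f) y,
  selects (Ws a f) (z a) (target y) & covers (z a) (side y)].
have c_seqs : countable color_seqs by exact: card_le_trans (card_image_le _ _) (countableP _).
have c_balls : countable balls by exact: card_le_trans (card_image_le _ _) (countableP _).
have seqs_balls c W : color_seqs c -> balls W -> respects W c.
  by move=> [xn _ <-] [ym _ <-]; exact: respects_color_seq.
(* Of two stages the later one takes the earlier into account, whichever of them supplies the
   side. *)
have cross f a b : P a f (f a) -> P b f (f b) -> respects (side (f a)) (target (f b)).
  move=> [Ea _ _] [Eb _ _]; have [ab|->|ba] := Rtot a b.
  - by apply: ext_target Eb _ _; right; exists a.
  - exact: ext_self Eb.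
  - by apply: ext_side Ea _ _; right; exists b.
have [f fP] : exists f, forall a, P a f (f a).
  apply: (@wf_choice _ _ R) => //; first by exists; exact: (Stage (0, set0) set0 set0).
    move=> a f g y fg.
    have E Z (h : stage -> Z) : (h \o f) @` [set b | R b a] = (h \o g) @` [set b | R b a].
      by apply: eq_imagel => b /fg /= ->.
    by rewrite /P /Cs /Ws /Js !E.
  move=> a f fP; apply: extension => //; split.
  - by apply: small_setU; [exact: small_countable|exact: small_image].
  - by apply: small_setU; [exact: small_countable|exact: small_image].
  - by apply: small_setU; [exact/small_countable/countable1|exact: small_image].
  - by move=> c ?; left.
  - by move=> c ?; left.
  - by left.
  - move=> c W [Cc|[b ba <-]] [BW|[b' b'a <-]] /=.
    + exact: seqs_balls.
    + by have [E _ _] := fP _ b'a; apply: ext_side E _ _; left.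
    + by have [E _ _] := fP _ ba; apply: ext_target E _ _; left.
    + by apply: cross; exact: fP.
  - move=> J [->|[b ba <-]]; first exact: infinite_nat.
    by have [E _ _] := fP _ ba; exact: ext_inf E.
  - move=> J K [->|[b ba <-]] [->|[c ca <-]]; rewrite ?setDT; try by [left|right].
    have [Eb _ _] := fP _ ba; have [Ec _ _] := fP _ ca.
    have [bc|->|cb] := Rtot b c.
    + by right; apply: ext_sub Ec _ _; right; exists b.
    + by left; rewrite setDv.
    + by left; apply: ext_sub Eb _ _; right; exists c.
  - move=> c [[[x n] _ <-]|[b ba <-]].
      (* The sequence has a single colour, so the full set of colours already serves as its
         reserve. *)
      exists setT; first by left.
      by apply: sub_finite_set (finite_set1 n) => k [_ [s /color_seqP sn <-]].
    have [E _ _] := fP _ ba; exists (reserve (f b)); first by right; exists b.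
    exact: ext_reserve E.
exists (color_seqs `|` range (target \o f)), (balls `|` range (side \o f)); split.
- by move=> c ?; left.
- by move=> c ?; left.
- move=> c W [Cc|[b _ <-]] [BW|[b' _ <-]] /=.
  + exact: seqs_balls.
  + by have [E _ _] := fP b'; apply: ext_side E _ _; left.
  + by have [E _ _] := fP b; apply: ext_target E _ _; left.
  + exact: cross.
- move=> x; have [a <-] := zsurj x; have [_ sel cov] := fP a.
  exists (target (f a)); first by right; exists a.
  exists (side (f a)); first by right; exists a.
  split=> // cl; apply: sel => n G Gfin GW; apply: cl => // W /GW.
  by move=> [BW|[b _ <-]]; [left|right; exists b].
Qed.

(** * The topology generated by a family of sets and their complements *)

Definition agree_space (T : choiceType) of set (set T) : Type := T.

HB.instance Definition _ (T : choiceType) (Ws : set (set T)) :=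
  Choice.copy (agree_space Ws) T.

Section agree_topology.
Variables (T : choiceType) (Ws : set (set T)).
Local Notation agree_space := (agree_space Ws).

Let agree_open (U : set agree_space) := forall x, U x ->
  exists G, [/\ finite_set G, G `<=` Ws & agree G x `<=` U].

Let agree_openT : agree_open setT.
Proof. by move=> x _; exists set0; split. Qed.

Let agree_openI : setI_closed agree_open.
Proof.
move=> U V oU oV x [/oU[G [Gfin GW GU]] /oV[H [Hfin HW HV]]].
exists (G `|` H); split; first by rewrite finite_setU.
  by move=> W [/GW|/HW].
by rewrite agreeU => y [/GU Uy /HV].
Qed.

Let agree_open_bigU (I : Type) (f : I -> set agree_space) :
  (forall i, agree_open (f i)) -> agree_open (\bigcup_i f i).
Proof.
move=> of_ x [i _ /of_[G [Gfin GW Gf]]]; exists G; split=> // y /Gf.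
by exists i.
Qed.

HB.instance Definition _ := isOpenTopological.Build agree_space
  agree_openT agree_openI agree_open_bigU.

Lemma agree_spaceP (U : set agree_space) : open U <-> forall x, U x ->
  exists G, [/\ finite_set G, G `<=` Ws & agree G x `<=` U].
Proof. by []. Qed.

Lemma open_agree G (x : agree_space) :
  finite_set G -> G `<=` Ws -> open (agree G x : set agree_space).
Proof.
move=> Gfin GW; apply/agree_spaceP => y xy; exists G; split=> // z yz W GW'.
by apply: iff_trans (yz _ GW') (xy _ GW').
Qed.

Lemma clopen_agree G (x : agree_space) :
  finite_set G -> G `<=` Ws -> clopen (agree G x : set agree_space).
Proof.
move=> Gfin GW; split; first exact: open_agree.
rewrite -openC; apply/agree_spaceP => y nxy; exists G; split=> // z yz xz.
by apply: nxy => W GW'; apply: iff_trans (iff_sym (yz _ GW')) (xz _ GW').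
Qed.

Lemma clopen_side W : Ws W -> clopen (W : set agree_space).
Proof.
move=> WW; split.
  apply/agree_spaceP => x Wx; exists [set W]; split=> //; first by move=> _ ->.
  by move=> y /(_ W erefl) [_]; exact.
rewrite -openC; apply/agree_spaceP => x Wx; exists [set W]; split=> //; first by move=> _ ->.
by move=> y /(_ W erefl) [yx _] /yx.
Qed.

Lemma set_converges_agree (S : set agree_space) (x : agree_space) :
  (forall W, Ws W -> respects W (x, S)) -> set_converges S x.
Proof.
move=> SW U /agree_spaceP oU /oU[G [Gfin GW GU]].
apply: sub_finite_set (bigcup_finite Gfin (fun W GW' => SW W (GW _ GW'))).
move=> s [Ss nUs]; apply: contrapT => h; apply: nUs; apply: GU => W GW'.
by apply: contrapT => nW; apply: h; exists W.
Qed.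

Lemma closure_agree (A : set agree_space) (x : agree_space) G :
  closure A x -> finite_set G -> G `<=` Ws -> (A `&` agree G x) !=set0.
Proof.
move=> clA Gfin GW; apply: clA; apply: open_nbhs_nbhs; split; first exact: open_agree.
by [].
Qed.

Lemma zero_dimensional_agree_space :
  [set: agree_space] !=set0 ->
  (forall x y, x <> y -> exists2 W, Ws W & ~ (W y <-> W x)) ->
  zero_dimensional_space agree_space.
Proof.
move=> ne sep; split=> //.
  move=> x y /eqP /sep[W WW nW].
  have G1 : [set W] `<=` Ws by move=> _ ->.
  exists (agree [set W] x); split; first exact: open_agree.
    by rewrite inE.
  by rewrite inE => /(_ W erefl).
exists clopen; first by [].
split; first by move=> U [].
move=> x U /=; rewrite nbhsE => -[V [oV Vx] VU].
have [G [Gfin GW GV]] := (iffLR (agree_spaceP V)) oV x Vx.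
exists (agree G x); first by split; [exact: clopen_agree|].
by move=> y /GV/VU.
Qed.

End agree_topology.

Lemma convergent_closure (Y : topologicalType) (S : set Y) (x : Y) :
  convergent_sets x S -> closure (S `\ x) x.
Proof.
move=> [Sinf _ Sx cS] U /=; rewrite nbhsE => -[V [oV Vx] VU].
have [s [Ss Vs]] := infinite_setN0 (infinite_almost_sub Sinf (cS V oV Vx)).
by exists s; split; [split=> //; exact: Sx|exact: VU].
Qed.

(** * Properties of the generic space *)

Section generic_space.
Variables (Cs : set (nat * set nat)) (Ws : set (set nat)).
Hypothesis gen : generic Cs Ws.
Let X := agree_space Ws.

Let Ws_ball x m : Ws (ball2 x m).
Proof. by have [_ WB _ _] := gen; apply: WB; exists (x, m). Qed.

Let Ws_sep x y : x <> y -> exists2 W, Ws W & ~ (W y <-> W x).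
Proof.
move=> xy; exists (ball2 x (x + y)) => //.
by case=> _ /(_ erefl)/ball2_sep e; apply/xy/esym/e.
Qed.

(** This excludes isolated points and makes the colour classes dense. *)
Let color_seq_meets (x : X) (n : nat) (U : set X) :
  open U -> U x -> infinite_set (color_seq x n `&` U).
Proof.
move=> oU Ux; apply: infinite_almost_sub; first exact: infinite_color_seq.
have [CC _ Cresp _] := gen.
apply: (@set_converges_agree _ Ws _ x) => // W WW; apply: Cresp => //.
by apply: CC; exists (x, n).
Qed.

Let generic_select (x : X) (A : nat -> set X) :
  (forall n, closure (A n `\ x) x) ->
  exists S, [/\ convergent_sets x S, S `<=` \bigcup_n (A n `\ x) &
                infinite_set [set n | A n `&` S !=set0]].
Proof.
(* Only a sequence is wanted here, so the candidate selection in the task is empty. *)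
move=> clA; have [_ _ Cresp /(_ (x, A, fun=> set0))] := gen.
move=> [[y S] CS [_ _ [sel _]]].
have [|/= yx Sinf SA Sn] := sel; first by move=> n G; exact: closure_agree.
rewrite {}yx in CS; exists S; split=> //; split=> //.
- exact: (@countableP nat).
- by move=> s /SA[n _ []].
- by apply: set_converges_agree => W; exact: Cresp CS.
Qed.

Lemma generic_frechet_urysohn : frechet_urysohn X.
Proof.
move=> A x [clA nAx]; have AxA : A `\ x = A.
  by apply/seteqP; split=> [y []//|y Ay]; split=> // yx; apply: nAx; rewrite -yx.
have [|S [Sx SA _]] := @generic_select x (fun=> A); first by rewrite AxA.
by exists S => // s /SA[_ _ []].
Qed.

Lemma generic_alpha4 : alpha4 X.
Proof.
move=> x S Sx; have [|T [Tx _ TS]] := @generic_select x S; last by exists T.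
by move=> n; exact: convergent_closure.
Qed.

Lemma generic_isolated : isolated [set: X] = set0.
Proof.
apply/seteqP; split=> // x [_ [V]]; rewrite nbhsE setIT => -[U [oU Ux] UV] Vx.
case: (@color_seq_meets x 0 U oU Ux); apply: sub_finite_set (finite_set1 x).
by move=> y [_ /UV]; rewrite Vx.
Qed.

Lemma generic_not_H_separable : ~ H_separable X.
Proof.
move=> /(_ (fun n => color @^-1` [set n] : set X))[|F [FD FU]].
  move=> n U [x Ux] oU.
  have [y [/color_seqP yn Uy]] := infinite_setN0 (@color_seq_meets x n U oU Ux).
  by exists y.
have [_ _ _ /(_ (0, fun=> set0, F))] := gen.
move=> [_ _ [W WW [_ []//[p nWp] Winf]]].
(* The complement of [W] is open and nonempty, yet misses each [F n] contained in [W]. *)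
apply: Winf; apply: sub_finite_set (FU (~` W) _ _).
- by move=> n FW [y [nWy /FW]].
- by rewrite openC; have [] := clopen_side WW.
- by exists p.
Qed.

Lemma generic_zero_dimensional : zero_dimensional_space X.
Proof. by apply: zero_dimensional_agree_space => //; exists 0. Qed.

End generic_space.

Unset Implicit Arguments.

Theorem theorem3p2 (p_eq_c : is_pseudointersection_number continuum) :
  exists X : topologicalType,
    [/\ countable [set: X], zero_dimensional_space X, frechet_urysohn X,
        alpha4 X & isolated [set: X] = set0 /\ ~ H_separable X].
Proof.
have [Cs [Ws gen]] := generic_exists p_eq_c.
exists (agree_space Ws); split.
- exact: (@countableP nat).
- exact: generic_zero_dimensional gen.
- exact: generic_frechet_urysohn gen.
- exact: generic_alpha4 gen.
- by split; [exact: generic_isolated gen|exact: generic_not_H_separable gen].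
Qed.
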